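(* Let $GML^n_p$ be a generalized metrical multi-time Lagrange space endowed with the canonical temporal nonlinear connection $M^{(i)}_{(\alpha)\beta}=-H^\mu_{\alpha\beta}x^i_\mu$ and a spatial nonlinear connection $N^{(i)}_{(\alpha)j}$, let $C\Gamma$ be its Cartan canonical connection, and let $G=h_{\alpha\beta}dt^\alpha\otimes dt^\beta+g_{ij}dx^i\otimes dx^j+h^{\alpha\beta}g_{ij}\delta x^i_\alpha\otimes\delta x^j_\beta$ be its gravitational $h$-potential. The Einstein equations $$Ric(C\Gamma)-\frac{Sc(C\Gamma)}{2}G={\cal K}{\cal T}$$ which govern $G$ have the local form $$\left\{\begin{array}{l}H_{\alpha\beta}-\dfrac{H+R+S}{2}h_{\alpha\beta}={\cal K}{\cal T}_{\alpha\beta}\\[2mm] R_{ij}-\dfrac{H+R+S}{2}g_{ij}={\cal K}{\cal T}_{ij}\\[2mm] S^{(\alpha)(\beta)}_{(i)(j)}-\dfrac{H+R+S}{2}h^{\alpha\beta}g_{ij}={\cal K}{\cal T}^{(\alpha)(\beta)}_{(i)(j)},\end{array}\right.$$ $$\left\{\begin{array}{lll}0={\cal T}_{\alpha i},&R_{i\alpha}={\cal K}{\cal T}_{i\alpha},&P^{(\alpha)}_{(i)\beta}={\cal K}{\cal T}^{(\alpha)}_{(i)\beta}\\[2mm] 0={\cal T}^{\;(\beta)}_{\alpha(i)},&P^{\;(\alpha)}_{i(j)}={\cal K}{\cal T}^{\;(\alpha)}_{i(j)},&P^{(\alpha)}_{(i)j}={\cal K}{\cal T}^{(\alpha)}_{(i)j},\end{array}\right.$$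 where ${\cal T}_{AB}$ are the adapted local components of the stress-energy d-tensor ${\cal T}$.
   Context: Setting. $T$ and $M$ are smooth real manifolds of dimensions $p$ and $n$, with local coordinates $(t^\alpha)$ and $(x^i)$; Greek indices run over $1,\dots,p$, Latin indices over $1,\dots,n$, and the summation convention is used. $E=J^1(T,M)\to T\times M$ is the first order jet bundle, with coordinates $(t^\alpha,x^i,x^i_\alpha)$ which change by $\tilde t^\alpha=\tilde t^\alpha(t^\beta)$, $\tilde x^i=\tilde x^i(x^j)$, $\tilde x^i_\alpha=\frac{\partial\tilde x^i}{\partial x^j}\frac{\partial t^\beta}{\partial\tilde t^\alpha}x^j_\beta$. A d-tensor on $E$ is a family of local functions on $E$ transforming tensorially: Greek indices with the Jacobian of $t\mapsto\tilde t$, Latin indices with that of $x\mapsto\tilde x$; indices in parentheses refer to vertical directions. $h=(h_{\alpha\beta}(t))$ is a fixed semi-Riemannian metric on $T$ with inverse $h^{\alpha\beta}$ and Christoffel symbols $H^\gamma_{\alpha\beta}$. $g_{ij}(t^\gamma,x^k,x^k_\gamma)$ is a d-tensor on $E$, symmetric, of rank $n$, of constant signature, with inverse $g^{ij}$. The pair $GML^n_p=(E,\,G^{(\alpha)(\beta)}_{(i)(j)}=h^{\alpha\beta}g_{ij})$ is called a generalized metrical multi-time Lagrange space. Nonlinear connection. $\Gamma=(M^{(i)}_{(\alpha)\beta},N^{(i)}_{(\alpha)j})$ is a family of local functions on $E$ such that $\frac{\delta}{\delta t^\alpha}=\frac{\partial}{\partial t^\alpha}-M^{(j)}_{(\beta)\alpha}\frac{\partial}{\partial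 x^j_\beta}$ and $\frac{\delta}{\delta x^i}=\frac{\partial}{\partial x^i}-N^{(j)}_{(\beta)i}\frac{\partial}{\partial x^j_\beta}$ transform tensorially. The adapted basis is $(X_A)=\left(\frac{\delta}{\delta t^\alpha},\frac{\delta}{\delta x^i},\frac{\partial}{\partial x^i_\alpha}\right)$, with dual basis $(dt^\alpha,dx^i,\delta x^i_\alpha)$, $\delta x^i_\alpha=dx^i_\alpha+M^{(i)}_{(\alpha)\beta}dt^\beta+N^{(i)}_{(\alpha)j}dx^j$. Cartan canonical connection. $C\Gamma=(H^\gamma_{\alpha\beta},G^k_{j\gamma},L^i_{jk},C^{i(\gamma)}_{j(k)})$, where $G^k_{j\gamma}=\frac{g^{ki}}{2}\frac{\delta g_{ij}}{\delta t^\gamma}$, $L^i_{jk}=\frac{g^{im}}{2}\left(\frac{\delta g_{mj}}{\delta x^k}+\frac{\delta g_{mk}}{\delta x^j}-\frac{\delta g_{jk}}{\delta x^m}\right)$, $C^{i(\gamma)}_{j(k)}=\frac{g^{im}}{2}\left(\frac{\partial g_{mj}}{\partial x^k_\gamma}+\frac{\partial g_{mk}}{\partial x^j_\gamma}-\frac{\partial g_{jk}}{\partial x^m_\gamma}\right)$, is the linear connection $\nabla$ on $E$ given by $\nabla_{\delta/\delta t^\gamma}\frac{\delta}{\delta t^\alpha}=H^\beta_{\alpha\gamma}\frac{\delta}{\delta t^\beta}$, $\nabla_{\delta/\delta x^k}\frac{\delta}{\delta t^\alpha}=0$, $\nabla_{\partial/\partial x^k_\gamma}\frac{\delta}{\delta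 t^\alpha}=0$; $\nabla_{\delta/\delta t^\gamma}\frac{\delta}{\delta x^j}=G^k_{j\gamma}\frac{\delta}{\delta x^k}$, $\nabla_{\delta/\delta x^k}\frac{\delta}{\delta x^j}=L^i_{jk}\frac{\delta}{\delta x^i}$, $\nabla_{\partial/\partial x^k_\gamma}\frac{\delta}{\delta x^j}=C^{i(\gamma)}_{j(k)}\frac{\delta}{\delta x^i}$; $\nabla_{\delta/\delta t^\gamma}\frac{\partial}{\partial x^i_\alpha}=G^k_{i\gamma}\frac{\partial}{\partial x^k_\alpha}-H^\alpha_{\eta\gamma}\frac{\partial}{\partial x^i_\eta}$, $\nabla_{\delta/\delta x^k}\frac{\partial}{\partial x^i_\alpha}=L^l_{ik}\frac{\partial}{\partial x^l_\alpha}$, $\nabla_{\partial/\partial x^k_\gamma}\frac{\partial}{\partial x^i_\alpha}=C^{l(\gamma)}_{i(k)}\frac{\partial}{\partial x^l_\alpha}$. Curvature: $\mathbf R(X,Y)Z=\nabla_X\nabla_YZ-\nabla_Y\nabla_XZ-\nabla_{[X,Y]}Z$, with components $\mathbf R(X_C,X_B)X_A=R^D_{ABC}X_D$; the named curvature d-tensors are given by $\mathbf R(\frac{\delta}{\delta t^\gamma},\frac{\delta}{\delta t^\beta})\frac{\delta}{\delta t^\eta}=H^\alpha_{\eta\beta\gamma}\frac{\delta}{\delta t^\alpha}$; $\mathbf R(\frac{\delta}{\delta x^k},\frac{\delta}{\delta t^\beta})\frac{\delta}{\delta x^i}=R^l_{i\beta k}\frac{\delta}{\delta x^l}$; $\mathbf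 R(\frac{\delta}{\delta x^k},\frac{\delta}{\delta x^j})\frac{\delta}{\delta x^i}=R^l_{ijk}\frac{\delta}{\delta x^l}$; $\mathbf R(\frac{\partial}{\partial x^k_\gamma},\frac{\delta}{\delta t^\beta})\frac{\delta}{\delta x^i}=P^{l\;(\gamma)}_{i\beta(k)}\frac{\delta}{\delta x^l}$; $\mathbf R(\frac{\partial}{\partial x^k_\gamma},\frac{\delta}{\delta x^j})\frac{\delta}{\delta x^i}=P^{l\;(\gamma)}_{ij(k)}\frac{\delta}{\delta x^l}$; $\mathbf R(\frac{\partial}{\partial x^k_\gamma},\frac{\partial}{\partial x^j_\beta})\frac{\delta}{\delta x^i}=S^{l(\beta)(\gamma)}_{i(j)(k)}\frac{\delta}{\delta x^l}$. Ricci: $Ric(X_A,X_B)=R_{AB}=R^D_{ABD}$, and $Sc(C\Gamma)=G^{AB}R_{AB}$, where $(G^{AB})$ is the inverse of the matrix of $G$ in the adapted basis. Notation: $H_{\alpha\beta}=H^\mu_{\alpha\beta\mu}$, $R_{i\alpha}=R^m_{i\alpha m}$, $R_{ij}=R^m_{ijm}$, $P^{\;(\alpha)}_{i(j)}=-P^{m\;(\alpha)}_{im(j)}$, $P^{(\alpha)}_{(i)j}=P^{m\;(\alpha)}_{ij(m)}$, $P^{(\alpha)}_{(i)\beta}=P^{m\;(\alpha)}_{i\beta(m)}$, $S^{(\alpha)(\beta)}_{(i)(j)}=S^{m(\beta)(\alpha)}_{i(j)(m)}$; $H=h^{\alpha\beta}H_{\alpha\beta}$, $R=g^{ij}R_{ij}$,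 $S=h_{\alpha\beta}g^{ij}S^{(\alpha)(\beta)}_{(i)(j)}$. ${\cal K}\ne0$ is the Einstein constant and ${\cal T}$ is a d-tensor (bilinear form on $TE$), the stress-energy d-tensor, with ${\cal T}_{AB}={\cal T}(X_A,X_B)$; a component index $(i)$ paired with $(\alpha)$ stands for $\frac{\partial}{\partial x^i_\alpha}$, e.g. ${\cal T}^{(\alpha)}_{(i)j}={\cal T}(\frac{\partial}{\partial x^i_\alpha},\frac{\delta}{\delta x^j})$. *)

(* Defs.v *)
From HB Require Import structures.
From mathcomp Require Import all_boot all_order all_algebra.
From mathcomp Require Import all_classical all_reals all_analysis.
Import Order.TTheory GRing.Theory Num.Theory.
Import numFieldNormedType.Exports.

Set Implicit Arguments.
Unset Strict Implicit.
Unset Printing Implicit Defensive.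

Local Open Scope classical_set_scope.
Local Open Scope ring_scope.

(* C^oo on an open set D: all iterated directional derivatives exist and are
   differentiable at the points of D. *)
Fixpoint iter_derive (R : realType) (V W : normedModType R) (s : seq V)
    (f : V -> W) : V -> W :=
  if s is v :: s' then fun x => 'D_v (iter_derive s' f) x else f.

Definition smooth_on (R : realType) (V W : normedModType R) (D : set V)
    (f : V -> W) : Prop :=
  forall (s : seq V) (x : V), D x -> differentiable (iter_derive s f) x.

(* pderiv f x a b = (d f^b / d x^a)(x) *)
Definition pderiv (R : realType) (d e : nat) (f : 'rV[R]_d -> 'rV[R]_e)
    (x : 'rV[R]_d) (a : 'I_d) (b : 'I_e) : R :=
  'D_(delta_mx 0 a) (fun y => f y 0 b) x.

(* chart_inv is meaningful on chart_map @` chart_dom only. *)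
Record chart (R : realType) (d : nat) (X : topologicalType) := Chart {
  chart_dom : set X ;
  chart_map : X -> 'rV[R]_d ;
  chart_inv : 'rV[R]_d -> X ;
  chart_dom_open : open chart_dom ;
  chart_img_open : open (chart_map @` chart_dom) ;
  chart_mapK : forall x, chart_dom x -> chart_inv (chart_map x) = x ;
  chart_map_cont : {within chart_dom, continuous chart_map} ;
  chart_inv_cont : {within chart_map @` chart_dom, continuous chart_inv}
}.

Section Charts.
Context {R : realType} {d : nat} {X : topologicalType}.
Implicit Types a b : chart R d X.

Definition chart_img a : set 'rV[R]_d := chart_map a @` chart_dom a.

Definition overlap a b : set 'rV[R]_d :=
  chart_map a @` (chart_dom a `&` chart_dom b).

(* the change of coordinates from a to b, meaningful on overlap a b *)
Definition transition a b (t : 'rV[R]_d) : 'rV[R]_d :=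
  chart_map b (chart_inv a t).

End Charts.

Record manifold (R : realType) (d : nat) := Manifold {
  carrier :> topologicalType ;
  manifold_hausdorff : hausdorff_space carrier ;
  manifold_countable : @second_countable carrier ;
  atlas : Type ;
  chart_at : atlas -> chart R d carrier ;
  atlas_cover : forall x : carrier, exists a, chart_dom (chart_at a) x ;
  atlas_smooth : forall a b,
    smooth_on (overlap (chart_at a) (chart_at b))
              (transition (chart_at a) (chart_at b))
}.

(* The symmetric matrix A is congruent to diag(-1, .., -1, 1, .., 1), with q
   entries equal to -1. *)
Definition has_signature (R : realType) (d q : nat) (A : 'M[R]_d) : Prop :=
  exists2 P : 'M[R]_d, P \in unitmx &
    P^T *m A *m P = diag_mx (\row_(i < d) (if (i < q)%N then -1 else 1)).

Record semi_riemannian (R : realType) (p : nat) (T : manifold R p) :=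
  SemiRiemannian {
  hmet :> atlas T -> 'rV[R]_p -> 'M[R]_p ;
  hmet_smooth : forall a al be,
    smooth_on (chart_img (chart_at a)) (fun t => hmet a t al be) ;
  hmet_sym : forall a t, chart_img (chart_at a) t -> (hmet a t)^T = hmet a t ;
  hmet_unit : forall a t, chart_img (chart_at a) t -> hmet a t \in unitmx ;
  hmet_signature : exists q : nat, forall a t,
    chart_img (chart_at a) t -> has_signature q (hmet a t) ;
  hmet_tensor : forall (a a' : atlas T) t al be,
    overlap (chart_at a) (chart_at a') t ->
    let tau := transition (chart_at a) (chart_at a') in
    let tau' := transition (chart_at a') (chart_at a) in
    hmet a' (tau t) al be =
      \sum_(ga < p) \sum_(de < p)
        pderiv tau' (tau t) al ga * pderiv tau' (tau t) be de * hmet a t ga de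
}.

(* Coordinates (t, x, y) of J^1(T, M): y i al stands for x^i_al.  The same
   type serves for the tangent vectors in these coordinates. *)
Notation jet R p n := ('rV[R]_p * 'rV[R]_n * 'M[R]_(n, p))%type.

(* Indices A of the adapted basis: It al, Ix i and Iv i al are the indices of
   delta/delta t^al, delta/delta x^i and d/dx^i_al. *)
Notation jindex p n := ('I_p + 'I_n + 'I_n * 'I_p)%type.
Notation It al := (inl (inl al)).
Notation Ix i := (inl (inr i)).
Notation Iv i al := (inr (i, al)).

Section JetCoordinates.
Context {R : realType} {p n : nat} {X Y : topologicalType}.
Implicit Types (a : chart R p X) (b : chart R n Y).

Definition jet_dom a b : set (jet R p n) :=
  [set u | chart_img a u.1.1 /\ chart_img b u.1.2].

Definition jet_overlap a b a' b' : set (jet R p n) :=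
  [set u | overlap a a' u.1.1 /\ overlap b b' u.1.2].

Definition jet_change a b a' b' (u : jet R p n) : jet R p n :=
  (transition a a' u.1.1, transition b b' u.1.2,
   \matrix_(i < n, al < p) \sum_(j < n) \sum_(be < p)
     pderiv (transition b b') u.1.2 j i *
     pderiv (transition a' a) (transition a a' u.1.1) al be * u.2 j be).

End JetCoordinates.

Record gml_space (R : realType) (p n : nat)
    (T : manifold R p) (M : manifold R n) := GMLSpace {
  gml_h : semi_riemannian T ;
  gml_g : atlas T -> atlas M -> jet R p n -> 'M[R]_n ;
  gml_g_smooth : forall a b i j,
    smooth_on (jet_dom (chart_at a) (chart_at b)) (fun u => gml_g a b u i j) ;
  gml_g_sym : forall a b u, jet_dom (chart_at a) (chart_at b) u ->
    (gml_g a b u)^T = gml_g a b u ;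
  gml_g_rank : forall a b u, jet_dom (chart_at a) (chart_at b) u ->
    \rank (gml_g a b u) = n ;
  gml_g_signature : exists q : nat, forall a b u,
    jet_dom (chart_at a) (chart_at b) u -> has_signature q (gml_g a b u) ;
  gml_g_tensor : forall (a a' : atlas T) (b b' : atlas M) u i j,
    jet_overlap (chart_at a) (chart_at b) (chart_at a') (chart_at b') u ->
    let xi := transition (chart_at b) (chart_at b') in
    let xi' := transition (chart_at b') (chart_at b) in
    gml_g a' b'
      (jet_change (chart_at a) (chart_at b) (chart_at a') (chart_at b') u) i j
    = \sum_(k < n) \sum_(l < n)
        pderiv xi' (xi u.1.2) i k * pderiv xi' (xi u.1.2) j l *
        gml_g a b u k l
}.

(* The expressions, in one system of local coordinates, of h, g and of the
   spatial nonlinear connection: sN u i al j = N^(i)_(al)j. *)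
Record local_fields (R : realType) (p n : nat) := LocalFields {
  sh : 'rV[R]_p -> 'M[R]_p ;
  sg : jet R p n -> 'M[R]_n ;
  sN : jet R p n -> 'I_n -> 'I_p -> 'I_n -> R
}.

Section LocalGeometry.
Context {R : realType} {p n : nat} (F : local_fields R p n).
Local Notation V := (jet R p n).
Local Notation idx := (jindex p n).
Implicit Types (u : V) (A B C D : idx) (X Y Z : V -> V).

Definition hinv (t : 'rV[R]_p) (al be : 'I_p) : R := invmx (sh F t) al be.
Definition ginv u (i j : 'I_n) : R := invmx (sg F u) i j.

(* H^ga_(al be) *)
Definition christoffel (ga al be : 'I_p) (t : 'rV[R]_p) : R :=
  let dh (k i j : 'I_p) := 'D_(delta_mx 0 k) (fun s => sh F s i j) t in
  \sum_(eta < p) hinv t ga eta / 2 * (dh be eta al + dh al eta be - dh eta al be).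

(* M^(i)_(al)be *)
Definition canonicalM u (i : 'I_n) (al be : 'I_p) : R :=
  - \sum_(mu < p) christoffel mu al be u.1.1 * u.2 i mu.

Definition frame A u : V :=
  match A with
  | It al => (delta_mx 0 al, 0, - \matrix_(j, be) canonicalM u j be al)
  | Ix i => (0, delta_mx 0 i, - \matrix_(j, be) sN F u j be i)
  | Iv i al => (0, 0, delta_mx i al)
  end.

Definition coframe A u (v : V) : R :=
  match A with
  | It al => v.1.1 0 al
  | Ix i => v.1.2 0 i
  | Iv i al => v.2 i al + \sum_(be < p) canonicalM u i al be * v.1.1 0 be
                        + \sum_(j < n) sN F u i al j * v.1.2 0 j
  end.

(* the action of X_A on functions *)
Definition dframe A (f : V -> R) u : R := 'D_(frame A u) f u.

(* G^k_(j ga) *)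
Definition cartanG (k j : 'I_n) (ga : 'I_p) u : R :=
  \sum_(i < n) ginv u k i / 2 * dframe (It ga) (fun w => sg F w i j) u.

(* L^i_(j k) *)
Definition cartanL (i j k : 'I_n) u : R :=
  let dg (l r s : 'I_n) := dframe (Ix l) (fun w => sg F w r s) u in
  \sum_(m < n) ginv u i m / 2 * (dg k m j + dg j m k - dg m j k).

(* C^(i (ga))_(j (k)) *)
Definition cartanC (i j k : 'I_n) (ga : 'I_p) u : R :=
  let dg (l r s : 'I_n) := dframe (Iv l ga) (fun w => sg F w r s) u in
  \sum_(m < n) ginv u i m / 2 * (dg k m j + dg j m k - dg m j k).

(* nabla_(X_A) X_B at u, for the Cartan canonical connection *)
Definition nabla_frame A B u : V :=
  match A, B with
  | It ga, It al =>
      \sum_(be < p) christoffel be al ga u.1.1 *: frame (It be) u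
  | Ix _, It _ => 0
  | Iv _ _, It _ => 0
  | It ga, Ix j => \sum_(k < n) cartanG k j ga u *: frame (Ix k) u
  | Ix k, Ix j => \sum_(i < n) cartanL i j k u *: frame (Ix i) u
  | Iv k ga, Ix j => \sum_(i < n) cartanC i j k ga u *: frame (Ix i) u
  | It ga, Iv i al =>
      \sum_(k < n) cartanG k i ga u *: frame (Iv k al) u
      - \sum_(eta < p) christoffel al eta ga u.1.1 *: frame (Iv i eta) u
  | Ix k, Iv i al => \sum_(l < n) cartanL l i k u *: frame (Iv l al) u
  | Iv k ga, Iv i al => \sum_(l < n) cartanC l i k ga u *: frame (Iv l al) u
  end.

(* Extension to all vector fields by linearity in X and the Leibniz rule in
   Y = sum_B Y^B X_B. *)
Definition nabla X Y : V -> V := fun u =>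
  \sum_(A : idx) coframe A u (X u) *:
    \sum_(B : idx) (dframe A (fun w => coframe B w (Y w)) u *: frame B u
                    + coframe B u (Y u) *: nabla_frame A B u).

Definition lie_bracket X Y : V -> V := fun u =>
  'D_(X u) Y u - 'D_(Y u) X u.

Definition curvature X Y Z : V -> V := fun u =>
  nabla X (nabla Y Z) u - nabla Y (nabla X Z) u - nabla (lie_bracket X Y) Z u.

(* R^D_(A B C), where R(X_C, X_B) X_A = R^D_(A B C) X_D *)
Definition curv D A B C u : R :=
  coframe D u (curvature (frame C) (frame B) (frame A) u).

Definition curvH (al eta be ga : 'I_p) u : R :=
  curv (It al) (It eta) (It be) (It ga) u.
Definition curvRt (l i : 'I_n) (be : 'I_p) (k : 'I_n) u : R :=
  curv (Ix l) (Ix i) (It be) (Ix k) u.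
Definition curvR (l i j k : 'I_n) u : R :=
  curv (Ix l) (Ix i) (Ix j) (Ix k) u.
Definition curvPt (l i : 'I_n) (be ga : 'I_p) (k : 'I_n) u : R :=
  curv (Ix l) (Ix i) (It be) (Iv k ga) u.
Definition curvP (l i j : 'I_n) (ga : 'I_p) (k : 'I_n) u : R :=
  curv (Ix l) (Ix i) (Ix j) (Iv k ga) u.
Definition curvS (l i : 'I_n) (be ga : 'I_p) (j k : 'I_n) u : R :=
  curv (Ix l) (Ix i) (Iv j be) (Iv k ga) u.

(* H_(al be), R_(i al), R_(i j) *)
Definition ricH (al be : 'I_p) u : R := \sum_(mu < p) curvH mu al be mu u.
Definition ricRt (i : 'I_n) (al : 'I_p) u : R := \sum_(m < n) curvRt m i al m u.
Definition ricR (i j : 'I_n) u : R := \sum_(m < n) curvR m i j m u.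
(* P_(i (j))^((al)) *)
Definition ricPxv (i : 'I_n) (al : 'I_p) (j : 'I_n) u : R :=
  - \sum_(m < n) curvP m i m al j u.
(* P^((al))_((i) j) *)
Definition ricPvx (al : 'I_p) (i j : 'I_n) u : R :=
  \sum_(m < n) curvP m i j al m u.
(* P^((al))_((i) be) *)
Definition ricPvt (al : 'I_p) (i : 'I_n) (be : 'I_p) u : R :=
  \sum_(m < n) curvPt m i be al m u.
(* S^((al)(be))_((i)(j)) *)
Definition ricS (al be : 'I_p) (i j : 'I_n) u : R :=
  \sum_(m < n) curvS m i be al j m u.

Definition scalH u : R :=
  \sum_(al < p) \sum_(be < p) hinv u.1.1 al be * ricH al be u.
Definition scalR u : R :=
  \sum_(i < n) \sum_(j < n) ginv u i j * ricR i j u.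
Definition scalS u : R :=
  \sum_(al < p) \sum_(be < p) \sum_(i < n) \sum_(j < n)
    sh F u.1.1 al be * ginv u i j * ricS al be i j u.

(* R_(A B) = R^D_(A B D) *)
Definition ricci_comp A B u : R := \sum_(D : idx) curv D A B D u.

Definition ricci u (v w : V) : R :=
  \sum_(A : idx) \sum_(B : idx)
    coframe A u v * coframe B u w * ricci_comp A B u.

(* the gravitational h-potential G *)
Definition potential u (v w : V) : R :=
  \sum_(al < p) \sum_(be < p)
    sh F u.1.1 al be * (coframe (It al) u v * coframe (It be) u w)
  + \sum_(i < n) \sum_(j < n)
    sg F u i j * (coframe (Ix i) u v * coframe (Ix j) u w)
  + \sum_(al < p) \sum_(be < p) \sum_(i < n) \sum_(j < n)
    hinv u.1.1 al be * sg F u i j *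
      (coframe (Iv i al) u v * coframe (Iv j be) u w).

(* The matrix (G_AB) of G in the adapted basis (rows and columns enumerate
   the indices A), and the entries G^AB of its inverse. *)
Definition potential_mx u : 'M[R]_#|{: idx}| :=
  \matrix_(r, s) potential u (frame (enum_val r) u) (frame (enum_val s) u).
Definition potential_inv u A B : R :=
  invmx (potential_mx u) (enum_rank A) (enum_rank B).

Definition scalar_curvature u : R :=
  \sum_(A : idx) \sum_(B : idx) potential_inv u A B * ricci_comp A B u.

End LocalGeometry.

(* A spatial nonlinear connection: the vectors delta/delta x^i transform
   tensorially. *)
Record spatial_connection (R : realType) (p n : nat)
    (T : manifold R p) (M : manifold R n) (L : gml_space T M) :=
  SpatialConnection {
  spN : atlas T -> atlas M -> jet R p n -> 'I_n -> 'I_p -> 'I_n -> R ;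
  spN_smooth : forall a b i al j,
    smooth_on (jet_dom (chart_at a) (chart_at b)) (fun u => spN a b u i al j) ;
  spN_tensor : forall (a a' : atlas T) (b b' : atlas M) u i,
    jet_overlap (chart_at a) (chart_at b) (chart_at a') (chart_at b') u ->
    let Phi :=
      jet_change (chart_at a) (chart_at b) (chart_at a') (chart_at b') in
    let fields c d := LocalFields (gml_h L c) (gml_g L c d) (spN c d) in
    'D_(frame (fields a b) (Ix i) u) Phi u =
      \sum_(j < n) pderiv (transition (chart_at b) (chart_at b')) u.1.2 i j *:
        frame (fields a' b') (Ix j) (Phi u)
}.

Definition fields_at (R : realType) (p n : nat)
    (T : manifold R p) (M : manifold R n) (L : gml_space T M)
    (N : spatial_connection L) (a : atlas T) (b : atlas M) :
    local_fields R p n :=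
  LocalFields (gml_h L a) (gml_g L a b) (spN N a b).

(* A field of bilinear forms on the fibres of TE. *)
Record stress_energy (R : realType) (p n : nat)
    (T : manifold R p) (M : manifold R n) := StressEnergy {
  se_form :> atlas T -> atlas M -> jet R p n -> jet R p n -> jet R p n -> R ;
  se_linear_l : forall a b u w, jet_dom (chart_at a) (chart_at b) u ->
    scalar (fun v => se_form a b u v w) ;
  se_linear_r : forall a b u v, jet_dom (chart_at a) (chart_at b) u ->
    scalar (fun w => se_form a b u v w) ;
  se_tensor : forall (a a' : atlas T) (b b' : atlas M) u v w,
    jet_overlap (chart_at a) (chart_at b) (chart_at a') (chart_at b') u ->
    let Phi :=
      jet_change (chart_at a) (chart_at b) (chart_at a') (chart_at b') in
    se_form a' b' (Phi u) ('D_v Phi u) ('D_w Phi u) = se_form a b u v w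
}.

(* Main.v *)
(* The Cartan connection preserves the three blocks delta/delta t, delta/delta x
   and d/dx_al of the adapted frame; on the first one it depends on t only and
   is nonzero only along delta/delta t, and on the third one it is the tensor
   product of the connection on the second with the dual of the connection on
   the first.  As brackets of frame fields have no delta/delta t component, the
   first block is flat except in two temporal directions, so that the curvature
   of the third block along a vertical direction is that of the second block.
   This gives all the components of the Ricci tensor.  The potential is block
   diagonal, so its inverse is too and the scalar curvature is H + R + S. *)
Require Import Defs.
From HB Require Import structures.
From mathcomp Require Import all_boot all_order all_algebra.
From mathcomp Require Import all_classical all_reals all_analysis.
From mathcomp Require Import ring.
Import Order.TTheory GRing.Theory Num.Theory.
Import numFieldNormedType.Exports.

Set Implicit Arguments.
Unset Strict Implicit.
Unset Printing Implicit Defensive.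

Local Open Scope classical_set_scope.
Local Open Scope ring_scope.

(** * Directional derivatives, without differentiability hypotheses *)

Section Derivative.
Context {R : realType} {V : normedModType R}.

(** The difference quotients of [f] and [g] coincide, so their limits do too, whether or not they
    exist. A term that is constant along the line can thus be dropped without any regularity of the
    summands. *)
Lemma eq_derive_line (f g : V -> R) (u v : V) :
  (forall s : R, f (s *: v + u) - f u = g (s *: v + u) - g u) ->
  'D_v f u = 'D_v g u.
Proof.
move=> fg; rewrite /derive.
suff -> : (fun h : R => h^-1 *: ((f \o shift u) (h *: v) - f u)) =
          (fun h => h^-1 *: ((g \o shift u) (h *: v) - g u)) by [].
by apply/funext => h /=; rewrite fg.
Qed.

Lemma derive_line_cst (f : V -> R) (u v : V) :
  (forall s : R, f (s *: v + u) = f u) -> 'D_v f u = 0.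
Proof.
move=> fu; rewrite -(derive_cst (0 : R) u v); apply: eq_derive_line => s.
by rewrite fu !subrr.
Qed.

(* Y need not be derivable: the junk value of the derivative is the point of
   the product space, whose coordinates are 0. *)
Lemma derive_time_cst p n (Y : V -> jet R p n) (u v : V) (al : 'I_p) :
  (forall w, (Y w).1.1 0 al = (Y u).1.1 0 al) -> ('D_v Y u).1.1 0 al = 0.
Proof.
move=> Ycst; have [dY|/dvgP] := pselect (derivable Y u v); last first.
  by rewrite /derive => ->; rewrite mxE.
pose q (h : R) := h^-1 *: ((Y \o shift u) (h *: v) - Y u).
have qD : q @ 0^' --> 'D_v Y u := dY.
have phi_cont : continuous (fun w : jet R p n => w.1.1 0 al).
  move=> w; apply: (@continuous_comp _ _ _ (fun w : jet R p n => w.1.1)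
    (fun t : 'rV[R]_p => t 0 al)); last exact: coord_continuous.
  by apply: (@continuous_comp _ _ _ fst fst); [exact: cvg_fst|exact: cvg_fst].
have qE : (fun h => (q h).1.1 0 al) = cst 0.
  by apply/funext => h; rewrite /q /= !mxE /= Ycst subrr mulr0.
have : (fun h => (q h).1.1 0 al) @ 0^' --> ('D_v Y u).1.1 0 al.
  exact: continuous_cvg (phi_cont _) qD.
by rewrite qE => c0; apply: cvg_unique c0 (cvg_cst _).
Qed.

End Derivative.

(** * The adapted frame and its dual coframe *)

Section AdaptedFrame.
Context {R : realType} {p n : nat} (F : local_fields R p n).
Local Notation V := (jet R p n).
Local Notation idx := (jindex p n).
Implicit Types (u : V) (A B C D E : idx).

Lemma sum_jindex (W : zmodType) (f : idx -> W) :
  \sum_A f A = \sum_al f (It al) + \sum_i f (Ix i)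
               + \sum_i \sum_al f (Iv i al).
Proof.
rewrite big_sumType big_sumType /= pair_bigA /=; congr (_ + _).
by apply: eq_bigr => -[].
Qed.

Lemma coframe_scalar D u : scalar (coframe F D u).
Proof.
have sum2 m (c : 'I_m -> R) (k : R) (x y : 'rV[R]_m) :
    \sum_i c i * (k *: x + y) 0 i =
    k * \sum_i c i * x 0 i + \sum_i c i * y 0 i.
  rewrite mulr_sumr -big_split /=; apply: eq_bigr => i _.
  by rewrite !mxE mulrDr mulrCA.
move=> k v w; case: D => [[al|i]|[i al]] /=; rewrite ?sum2 !mxE //.
by ring.
Qed.

HB.instance Definition _ D u :=
  GRing.isLinear.Build R V R _ (coframe F D u) (coframe_scalar D u).

Lemma coframeB D u (v w : V) :
  coframe F D u (v - w) = coframe F D u v - coframe F D u w.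
Proof. exact: linearB. Qed.

Lemma coframe_frame D E u : coframe F D u (frame F E u) = (D == E)%:R.
Proof.
have sum0 m (c : 'I_m -> R) : \sum_i c i * (0 : 'rV[R]_m) 0 i = 0.
  by apply: big1 => i _; rewrite mxE mulr0.
have sum1 m (c : 'I_m -> R) j : \sum_i c i * delta_mx (0 : 'I_1) j 0 i = c j.
  rewrite (bigD1 j) //= big1 ?addr0 ?mxE ?eqxx ?mulr1 // => i ij.
  by rewrite mxE (negbTE ij) andbF mulr0.
case: D E => [[al|i]|[i al]] [[be|j]|[j be]] /=;
  rewrite ?sum0 ?sum1 ?mxE ?eqxx ?addr0 ?add0r ?addNr //.
Qed.

Lemma coframe_sum D u (c : idx -> R) :
  coframe F D u (\sum_A c A *: frame F A u) = c D.
Proof.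
rewrite linear_sum (bigD1 D) //= linearZ /= coframe_frame eqxx mulr1.
rewrite big1 ?addr0 // => A AD.
by rewrite linearZ /= coframe_frame eq_sym (negbTE AD) mulr0.
Qed.

(** The coframe is triangular: the forms $dt$ and $dx$ read off the first two parts of [v], and once
    these vanish the connection terms disappear from $\delta x^i_\alpha$. *)
Lemma coframe_eq0 u (v : V) : (forall D, coframe F D u v = 0) -> v = 0.
Proof.
case: v => [[t x] y] v0.
have t0 : t = 0 by apply/matrixP => i al; rewrite ord1 mxE; exact: v0 (It al).
have x0 : x = 0 by apply/matrixP => k i; rewrite ord1 mxE; exact: v0 (Ix i).
have sum0 m (c : 'I_m -> R) : \sum_i c i * (0 : 'rV[R]_m) 0 i = 0.
  by apply: big1 => i _; rewrite mxE mulr0.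
move: v0; rewrite t0 x0 => v0.
congr (_, _, _); apply/matrixP => i al; rewrite mxE.
by have := v0 (Iv i al); rewrite /= !sum0 !addr0.
Qed.

Lemma frame_decomp u (v : V) : v = \sum_A coframe F A u v *: frame F A u.
Proof.
apply/eqP; rewrite -subr_eq0; apply/eqP; apply: (@coframe_eq0 u) => D.
by rewrite coframeB /= coframe_sum subrr.
Qed.

(** The $dt^\alpha$-coordinate of every frame field is constant, so both derivatives in the bracket
    have zero temporal part, even where the connection coefficients are not derivable. *)
Lemma lie_bracket_time u A B al :
  coframe F (It al) u (lie_bracket (frame F A) (frame F B) u) = 0.
Proof.
have cstC C w : (frame F C w).1.1 0 al = (frame F C u).1.1 0 al.
  by case: C => [[?|?]|[? ?]].
have sub0 (v w : V) : v.1.1 0 al = 0 -> w.1.1 0 al = 0 ->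
    coframe F (It al) u (v - w) = 0.
  by rewrite coframeB /= => -> ->; rewrite subrr.
by apply: sub0; apply: derive_time_cst; exact: cstC.
Qed.

(** * Connection coefficients and curvature in the adapted frame *)

Definition conn D A B u : R := coframe F D u (nabla_frame F A B u).

Lemma coframe_nabla D (X Y : V -> V) u :
  coframe F D u (nabla F X Y u) =
  \sum_A coframe F A u (X u) *
    (dframe F A (fun w => coframe F D w (Y w)) u
     + \sum_B coframe F B u (Y u) * conn D A B u).
Proof.
rewrite /nabla linear_sum; apply: eq_bigr => A _.
rewrite linearZ /= big_split /= linearD /= coframe_sum; congr (_ * (_ + _)).
by rewrite linear_sum; apply: eq_bigr => B _; rewrite linearZ.
Qed.

Lemma dframe_cst A (c : R) u : dframe F A (fun=> c) u = 0.
Proof. exact: derive_cst. Qed.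

Lemma sum_coframe_frame A (f : idx -> R) u :
  \sum_B coframe F B u (frame F A u) * f B = f A.
Proof.
rewrite (bigD1 A) //= coframe_frame eqxx mul1r big1 ?addr0 // => B BA.
by rewrite coframe_frame (negbTE BA) mul0r.
Qed.

Lemma coframe_nabla_frame D A (Y : V -> V) u :
  coframe F D u (nabla F (frame F A) Y u) =
  dframe F A (fun w => coframe F D w (Y w)) u
  + \sum_E coframe F E u (Y u) * conn D A E u.
Proof. by rewrite coframe_nabla sum_coframe_frame. Qed.

Lemma coframe_nabla_frames D (X : V -> V) B u :
  coframe F D u (nabla F X (frame F B) u) =
  \sum_A coframe F A u (X u) * conn D A B u.
Proof.
rewrite coframe_nabla; apply: eq_bigr => A _; rewrite sum_coframe_frame.
have -> : (fun w => coframe F D w (frame F B w)) = fun=> (D == B)%:R.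
  by apply/funext => w; rewrite coframe_frame.
by rewrite dframe_cst add0r.
Qed.

(** The curvature formula in a nonholonomic frame. The coordinates of $\nabla_{X_B}X_A$ are exactly
    the functions [conn E B A], so the Leibniz rule built into [nabla] produces the derivative and
    quadratic terms; the last sum expands the bracket in the frame. *)
Lemma curvE D A B C u :
  curv F D A B C u =
  (dframe F C (conn D B A) u + \sum_E conn E B A u * conn D C E u)
  - (dframe F B (conn D C A) u + \sum_E conn E C A u * conn D B E u)
  - \sum_E coframe F E u (lie_bracket (frame F C) (frame F B) u)
           * conn D E A u.
Proof.
have nablaE X : (fun w => coframe F D w (nabla F (frame F X) (frame F A) w))
                = conn D X A.
  by apply/funext => w; rewrite coframe_nabla_frames sum_coframe_frame.
rewrite /curv /curvature !coframeB coframe_nabla_frames !coframe_nabla_frame.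
rewrite !nablaE; congr (_ + _ - (_ + _) - _); apply: eq_bigr => E _;
  by rewrite coframe_nabla_frames sum_coframe_frame.
Qed.

Lemma lie_bracketC (X Y : V -> V) u :
  lie_bracket X Y u = - lie_bracket Y X u.
Proof. by rewrite /lie_bracket opprB. Qed.

(** This accounts for the minus sign in [ricPxv], where the spatial and vertical directions stand in
    the order opposite to that of the Ricci contraction. *)
Lemma curv_antisym D A B C u : curv F D A B C u = - curv F D A C B u.
Proof.
rewrite !curvE [RHS]opprD opprB opprK; congr (_ + _).
rewrite -sumrN; apply: eq_bigr => E _.
by rewrite lie_bracketC linearN /= mulNr opprK.
Qed.

(** * Invariance of the temporal, spatial and vertical distributions, numbered 0, 1, 2 *)

Definition block A : nat :=
  match A with It _ => 0 | Ix _ => 1 | Iv _ _ => 2 end.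

Lemma coframe_sum_frame (I : finType) (c : I -> R) (e : I -> idx) D u :
  coframe F D u (\sum_i c i *: frame F (e i) u) = \sum_i c i * (D == e i)%:R.
Proof.
by rewrite linear_sum; apply: eq_bigr => i _; rewrite linearZ /= coframe_frame.
Qed.

(** Each of the nine defining cases of the connection expands $\nabla_{X_A}X_B$ in frame vectors of
    the same kind as $X_B$. *)
Lemma conn_block D A B u : block D != block B -> conn D A B u = 0.
Proof.
move=> DB.
have sum0 (I : finType) (c : I -> R) (e : I -> idx) :
    (forall i, block (e i) = block B) ->
    coframe F D u (\sum_i c i *: frame F (e i) u) = 0.
  move=> eB; rewrite coframe_sum_frame big1 // => i _.
  have [Dei|_] := eqVneq D (e i); last by rewrite mulr0.
  by move: DB; rewrite Dei eB eqxx.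
have sub0 (x y : R) : x = 0 -> y = 0 -> x - y = 0.
  by move=> -> ->; rewrite subrr.
move: sum0 {DB}; rewrite /conn.
case: A B => [[ga|k]|[k ga]] [[al|j]|[j al]] sum0; rewrite /nabla_frame;
  try exact: linear0.
- exact: (sum0 _ _ (fun be => It be)).
- exact: (sum0 _ _ (fun i => Ix i)).
- rewrite coframeB; apply: sub0.
    exact: (sum0 _ _ (fun i => Iv i al)).
  exact: (sum0 _ _ (fun be => Iv j be)).
- exact: (sum0 _ _ (fun i => Ix i)).
- exact: (sum0 _ _ (fun i => Iv i al)).
- exact: (sum0 _ _ (fun i => Ix i)).
- exact: (sum0 _ _ (fun i => Iv i al)).
Qed.

(** In each quadratic term the intermediate index would have to lie in the blocks of both [A] and
    [D]; the other terms contain a coefficient from [A] to [D], which is zero. *)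
Lemma curv_block D A B C u : block D != block A -> curv F D A B C u = 0.
Proof.
move=> DA.
have conn0 E : conn D E A = fun=> 0.
  by apply/funext => w; apply: conn_block.
have sum0 E E' : \sum_G conn G E A u * conn D E' G u = 0.
  apply: big1 => G _; have [GA|GA] := eqVneq (block G) (block A).
    by rewrite [X in _ * X]conn_block ?mulr0 // GA.
  by rewrite [X in X * _]conn_block ?mul0r.
rewrite curvE !sum0 !conn0 !dframe_cst subrr sub0r big1 ?oppr0 // => E _.
by rewrite conn_block ?mulr0.
Qed.

(** * Connection and curvature on the temporal and vertical distributions *)

Lemma Iv_eqE (i j : 'I_n) (al be : 'I_p) :
  ((Iv i al : idx) == Iv j be) = (i == j) && (al == be).
Proof. by []. Qed.

Lemma coframe_sum_time (c : 'I_p -> R) be u :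
  coframe F (It be) u (\sum_al c al *: frame F (It al) u) = c be.
Proof.
rewrite (coframe_sum_frame _ (fun al => It al)) (bigD1 be) //=.
rewrite eqxx mulr1 big1 ?addr0 // => al /negbTE albe.
by rewrite [It be == _]eq_sym [_ == It be]albe mulr0.
Qed.

Lemma coframe_sum_space (c : 'I_n -> R) i u :
  coframe F (Ix i) u (\sum_j c j *: frame F (Ix j) u) = c i.
Proof.
rewrite (coframe_sum_frame _ (fun j => Ix j)) (bigD1 i) //=.
rewrite eqxx mulr1 big1 ?addr0 // => j /negbTE ji.
by rewrite [Ix i == _]eq_sym [_ == Ix i]ji mulr0.
Qed.

Lemma coframe_sum_vertl (c : 'I_n -> R) i mu al u :
  coframe F (Iv i mu) u (\sum_j c j *: frame F (Iv j al) u)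
  = (mu == al)%:R * c i.
Proof.
rewrite (coframe_sum_frame _ (fun j => Iv j al)) (bigD1 i) //=.
rewrite Iv_eqE eqxx mulrC big1 ?addr0 // => j /negbTE ji.
by rewrite Iv_eqE eq_sym ji mulr0.
Qed.

Lemma coframe_sum_vertr (c : 'I_p -> R) i mu j u :
  coframe F (Iv i mu) u (\sum_al c al *: frame F (Iv j al) u)
  = (i == j)%:R * c mu.
Proof.
rewrite (coframe_sum_frame _ (fun al => Iv j al)) (bigD1 mu) //=.
rewrite Iv_eqE eqxx andbT mulrC big1 ?addr0 // => al /negbTE almu.
by rewrite Iv_eqE (eq_sym mu) almu andbF mulr0.
Qed.

Lemma conn_time0 D B al u : block B != 0%N -> conn D B (It al) u = 0.
Proof. by case: B => [[?|?]|[? ?]] // _; apply: linear0. Qed.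

Lemma conn_time be ga al u :
  conn (It be) (It ga) (It al) u = christoffel F be al ga u.1.1.
Proof. exact: coframe_sum_time. Qed.

(** The temporal coefficients are zero or Christoffel symbols, hence functions of $t$ alone, and
    spatial and vertical frame vectors leave $t$ fixed. The form along a line is the one that
    [eq_derive_line] and [derive_line_cst] take. *)
Lemma conn_time_shift be al B C u (s : R) : block C != 0%N ->
  conn (It be) B (It al) (s *: frame F C u + u) = conn (It be) B (It al) u.
Proof.
move=> C0; have [B0|B0] := eqVneq (block B) 0%N; last by rewrite !conn_time0.
case: B B0 => [[ga|?]|[? ?]] // _; rewrite !conn_time.
congr (christoffel F be al ga _).
by case: C C0 => [[?|?]|[? ?]] // _; rewrite /= scaler0 add0r.
Qed.

(** The Leibniz rule on a tensor product: $\partial/\partial x^i_\alpha$ behaves as $\delta/\delta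
    x^i\otimes dt^\alpha$. The minus sign and the exchange of [al] and [mu] in the last term come
    from the dual connection. *)
Lemma conn_vert m mu i al B u :
  conn (Iv m mu) B (Iv i al) u =
  (mu == al)%:R * conn (Ix m) B (Ix i) u
  - (m == i)%:R * conn (It al) B (It mu) u.
Proof.
have subD (x y z t : R) : x = y -> z = t -> x - z = y - t by move=> -> ->.
have sub0 (x y z : R) : x = y -> z = 0 -> x = y - (m == i)%:R * z.
  by move=> -> ->; rewrite mulr0 subr0.
case: B => [[ga|k]|[k ga]].
- rewrite conn_time.
  rewrite [conn (Ix _) _ _ _]coframe_sum_space.
  rewrite /conn /nabla_frame coframeB.
  by apply: subD; [exact: coframe_sum_vertl | exact: coframe_sum_vertr].
- apply: sub0; last by rewrite conn_time0.
  by rewrite [conn (Ix _) _ _ _]coframe_sum_space; exact: coframe_sum_vertl.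
- apply: sub0; last by rewrite conn_time0.
  by rewrite [conn (Ix _) _ _ _]coframe_sum_space; exact: coframe_sum_vertl.
Qed.

(** The temporal block carries a connection pulled back from $T$, so its curvature needs two
    temporal directions. This makes the mixed Ricci components with first index temporal vanish. *)
Lemma curv_time0 D al B C u : block B != 0%N -> curv F D (It al) B C u = 0.
Proof.
move=> B0; have [D0|D0] := eqVneq (block D) 0%N; last exact: curv_block.
case: D D0 => [[be|?]|[? ?]] // _.
have connB : conn (It be) B (It al) = fun=> 0.
  by apply/funext => w; apply: conn_time0.
have dconn : dframe F B (conn (It be) C (It al)) u = 0.
  by apply: derive_line_cst => s; apply: conn_time_shift.
rewrite curvE connB dframe_cst dconn.
rewrite [X in 0 + X]big1 => [|E _]; last first.
  by rewrite [X in X * _]conn_time0 ?mul0r.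
rewrite [X in _ - (0 + X)]big1 => [|E _]; last first.
  case: E => [[?|?]|[? ?]].
  - by rewrite [X in _ * X]conn_time0 ?mulr0.
  - by rewrite [X in X * _]conn_block ?mul0r.
  - by rewrite [X in X * _]conn_block ?mul0r.
rewrite big1 => [|E _]; first by rewrite !addr0 !subr0.
(* Only the bracket sum is left: a temporal [E] is excluded by the bracket, any other [E] by the
   coefficient. *)
case: E => [[?|?]|[? ?]]; first by rewrite lie_bracket_time mul0r.
  by rewrite [X in _ * X]conn_time0 ?mulr0.
by rewrite [X in _ * X]conn_time0 ?mulr0.
Qed.

Lemma sum_block_space (f : idx -> R) :
  (forall E, block E != 1%N -> f E = 0) -> \sum_E f E = \sum_i f (Ix i).
Proof.
move=> f0; rewrite sum_jindex big1 => [|al _]; last exact: f0.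
rewrite add0r [X in _ + X]big1 ?addr0 // => i _.
by apply: big1 => al _; exact: f0.
Qed.

Lemma sum_block_vert (f : idx -> R) :
  (forall E, block E != 2%N -> f E = 0) ->
  \sum_E f E = \sum_i \sum_al f (Iv i al).
Proof.
move=> f0; rewrite sum_jindex big1 => [|al _]; last exact: f0.
by rewrite add0r big1 ?add0r // => i _; exact: f0.
Qed.

Lemma sum_delta (I : finType) (f : I -> R) i :
  \sum_j (j == i)%:R * f j = f i.
Proof.
rewrite (bigD1 i) //= eqxx mul1r big1 ?addr0 // => j /negbTE ->.
by rewrite mul0r.
Qed.

(** On the tensor product of [conn_vert] the curvature is that of the spatial factor minus that of
    the temporal one, and the latter vanishes because one direction is vertical. *)
Lemma curv_vert m mu i al B k ga u :
  curv F (Iv m mu) (Iv i al) B (Iv k ga) u =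
  (mu == al)%:R * curv F (Ix m) (Ix i) B (Iv k ga) u.
Proof.
set C := Iv k ga.
have connC l nu j be w :
    conn (Iv l nu) C (Iv j be) w = (nu == be)%:R * conn (Ix l) C (Ix j) w.
  by rewrite conn_vert [conn (It _) _ _ _]conn_time0 // mulr0 subr0.
(* The factor is 0 or 1, so the rule follows by cases, with no derivability of [f]. *)
have dframeM A (b : bool) (f : V -> R) :
    dframe F A (fun w => b%:R * f w) u = b%:R * dframe F A f u.
  case: b; last by under eq_fun do rewrite mul0r; rewrite dframe_cst mul0r.
  by under eq_fun do rewrite mul1r; rewrite mul1r.
have dB : dframe F C (conn (Iv m mu) B (Iv i al)) u =
          (mu == al)%:R * dframe F C (conn (Ix m) B (Ix i)) u.
  (* The temporal coefficient in direction [B] may be nonzero, but it does not change along the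
     vertical line. *)
  rewrite -dframeM; apply: eq_derive_line => s.
  by rewrite !conn_vert conn_time_shift //; ring.
have dC : dframe F B (conn (Iv m mu) C (Iv i al)) u =
          (mu == al)%:R * dframe F B (conn (Ix m) C (Ix i)) u.
  by rewrite -dframeM; congr (dframe F B _ u); apply/funext => w.
(* The cross term subtracted here is the same as in [sumCB], so the two cancel in the curvature. *)
have sumBC : \sum_E conn E B (Iv i al) u * conn (Iv m mu) C E u =
    (mu == al)%:R * (\sum_E conn E B (Ix i) u * conn (Ix m) C E u)
    - conn (It al) B (It mu) u * conn (Ix m) C (Ix i) u.
  rewrite sum_block_vert => [|E E2]; last by rewrite conn_block ?mul0r.
  rewrite sum_block_space => [|E E1]; last by rewrite conn_block ?mul0r.
  under eq_bigr => l _.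
    under eq_bigr => nu _ do rewrite connC mulrCA (eq_sym mu).
    rewrite sum_delta conn_vert mulrBl -!mulrA.
    over.
  by rewrite sumrB sum_delta mulr_sumr.
have sumCB : \sum_E conn E C (Iv i al) u * conn (Iv m mu) B E u =
    (mu == al)%:R * (\sum_E conn E C (Ix i) u * conn (Ix m) B E u)
    - conn (It al) B (It mu) u * conn (Ix m) C (Ix i) u.
  rewrite sum_block_vert => [|E E2]; last by rewrite conn_block ?mul0r.
  rewrite sum_block_space => [|E E1]; last by rewrite conn_block ?mul0r.
  under eq_bigr => l _.
    under eq_bigr => nu _ do rewrite connC -mulrA.
    rewrite sum_delta conn_vert mulrBr mulrCA [X in _ - X]mulrCA (eq_sym m).
    over.
  by rewrite sumrB sum_delta mulr_sumr [X in _ - X]mulrC.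
have bracket : \sum_E coframe F E u (lie_bracket (frame F C) (frame F B) u) *
                  conn (Iv m mu) E (Iv i al) u =
    (mu == al)%:R *
    \sum_E coframe F E u (lie_bracket (frame F C) (frame F B) u) *
           conn (Ix m) E (Ix i) u.
  rewrite mulr_sumr; apply: eq_bigr => E _; rewrite conn_vert.
  case: E => [[ga'|?]|[? ?]]; first by rewrite lie_bracket_time !mul0r mulr0.
    by rewrite [conn (It _) _ _ _]conn_time0 // mulr0 subr0 mulrCA.
  by rewrite [conn (It _) _ _ _]conn_time0 // mulr0 subr0 mulrCA.
rewrite !curvE dB dC sumBC sumCB bracket.
by ring.
Qed.

(** * Components of the Ricci tensor *)

Lemma ricci_compE A B u :
  ricci_comp F A B u =
  match A, B with
  | It al, It be => ricH F al be u
  | It _, _ => 0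
  | Ix i, It al => ricRt F i al u
  | Ix i, Ix j => ricR F i j u
  | Ix i, Iv j al => ricPxv F i al j u
  | Iv i al, It be => ricPvt F al i be u
  | Iv i al, Ix j => ricPvx F al i j u
  | Iv i al, Iv j be => ricS F al be i j u
  end.
Proof.
(* The contraction runs over pairs [(m, mu)]; the Kronecker symbol of [curv_vert] keeps only
   [mu = al], which leaves a purely spatial trace. *)
have vertE i al C : ricci_comp F (Iv i al) C u =
    \sum_m curv F (Ix m) (Ix i) C (Iv m al) u.
  rewrite /ricci_comp sum_block_vert => [|E E2]; last exact: curv_block.
  apply: eq_bigr => m _.
  by under eq_bigr => mu _ do rewrite curv_vert; rewrite sum_delta.
have spaceE i C : ricci_comp F (Ix i) C u =
    \sum_m curv F (Ix m) (Ix i) C (Ix m) u.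
  by rewrite /ricci_comp sum_block_space // => E E1; exact: curv_block.
case: A => [[al|i]|[i al]]; last by rewrite vertE; case: B => [[be|j]|[j be]].
  case: B => [[be|j]|[j be]]; rewrite /ricci_comp.
  - rewrite sum_jindex [X in _ + X]big1 => [|i _]; last first.
      by rewrite big1 // => be' _; exact: curv_block.
    rewrite [X in _ + X + _]big1 => [|i _]; last exact: curv_block.
    by rewrite !addr0.
  - by rewrite big1 // => D _; exact: curv_time0.
  - by rewrite big1 // => D _; exact: curv_time0.
rewrite spaceE; case: B => [[be|j]|[j be]] //.
rewrite /ricPxv -sumrN; apply: eq_bigr => m _; exact: curv_antisym.
Qed.

(** * The potential, its inverse and the scalar curvature *)

Definition potential_comp A B u : R :=
  match A, B with
  | It al, It be => sh F u.1.1 al be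
  | Ix i, Ix j => sg F u i j
  | Iv i al, Iv j be => hinv F u.1.1 al be * sg F u i j
  | _, _ => 0
  end.

Lemma potentialE u (v w : V) :
  potential F u v w =
  \sum_A \sum_B coframe F A u v * coframe F B u w * potential_comp A B u.
Proof.
rewrite sum_jindex; congr (_ + _ + _).
- apply: eq_bigr => al _; rewrite sum_jindex.
  rewrite [X in _ + X + _]big1 => [|i _]; last by rewrite mulr0.
  rewrite [X in _ + X]big1 => [|i _]; last first.
    by rewrite big1 // => be _; rewrite mulr0.
  by rewrite !addr0; apply: eq_bigr => be _; rewrite mulrC.
- apply: eq_bigr => i _; rewrite sum_block_space.
    by apply: eq_bigr => j _; rewrite mulrC.
  by case=> [[?|?]|[? ?]] // _; rewrite mulr0.
- under eq_bigr do rewrite exchange_big /=.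
  rewrite exchange_big; apply: eq_bigr => i _; apply: eq_bigr => al _.
  rewrite sum_block_vert; last by case=> [[?|?]|[? ?]] // _; rewrite mulr0.
  rewrite exchange_big; apply: eq_bigr => j _; apply: eq_bigr => be _.
  by rewrite mulrC.
Qed.

Lemma sum_frame_bilinear A B (f : idx -> idx -> R) u :
  \sum_C \sum_D coframe F C u (frame F A u) * coframe F D u (frame F B u)
                * f C D = f A B.
Proof.
under eq_bigr => C _.
  under eq_bigr => D _ do rewrite -mulrA.
  rewrite -mulr_sumr sum_coframe_frame.
  over.
by rewrite sum_coframe_frame.
Qed.

Lemma potential_frame A B u :
  potential F u (frame F A u) (frame F B u) = potential_comp A B u.
Proof.
rewrite potentialE.
exact: (sum_frame_bilinear A B (fun C D => potential_comp C D u)).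
Qed.

(** The vertical block of the potential is the Kronecker product of $h^{-1}$ and $g$, so that of the
    inverse is the product of $h$ and $g^{-1}$. *)
Definition potential_inv_comp A B u : R :=
  match A, B with
  | It al, It be => hinv F u.1.1 al be
  | Ix i, Ix j => ginv F u i j
  | Iv i al, Iv j be => sh F u.1.1 al be * ginv F u i j
  | _, _ => 0
  end.

Lemma potential_comp_mulV A B u :
  sh F u.1.1 \in unitmx -> sg F u \in unitmx ->
  \sum_E potential_comp A E u * potential_inv_comp E B u = (A == B)%:R.
Proof.
move=> h_unit g_unit.
have mulE m (M N : 'M[R]_m) : M *m N = 1%:M ->
    forall i j, \sum_k M i k * N k j = (i == j)%:R.
  by move=> /matrixP MN i j; have := MN i j; rewrite !mxE.
have hhV := mulE _ _ _ (mulmxV h_unit).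
have hVh := mulE _ _ _ (mulVmx h_unit).
have ggV := mulE _ _ _ (mulmxV g_unit).
rewrite sum_jindex.
case: A => [[al|i]|[i al]] /=.
- rewrite [X in _ + X + _]big1 => [|? _]; last by rewrite mul0r.
  rewrite [X in _ + X]big1 => [|? _]; last first.
    by rewrite big1 // => ? _; rewrite mul0r.
  rewrite !addr0; case: B => [[be|j]|[j be]]; first exact: hhV.
    by rewrite big1 // => ? _; rewrite mulr0.
  by rewrite big1 // => ? _; rewrite mulr0.
- rewrite big1 => [|? _]; last by rewrite mul0r.
  rewrite [X in _ + X]big1 => [|? _]; last first.
    by rewrite big1 // => ? _; rewrite mul0r.
  rewrite addr0 add0r; case: B => [[be|j]|[j be]]; last 2 first.
  + exact: ggV.
  + by rewrite big1 // => ? _; rewrite mulr0.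
  by rewrite big1 // => ? _; rewrite mulr0.
rewrite big1 => [|? _]; last by rewrite mul0r.
rewrite [X in _ + X + _]big1 => [|? _]; last by rewrite mul0r.
rewrite !add0r; case: B => [[be|j]|[j be]].
- by rewrite big1 // => ? _; rewrite big1 // => ? _; rewrite mulr0.
- by rewrite big1 // => ? _; rewrite big1 // => ? _; rewrite mulr0.
(* Regrouping the four factors splits the double sum into an entry of $h^{-1}h$ times an entry of
   $gg^{-1}$. *)
under eq_bigr => k _.
  under eq_bigr => ga _ do rewrite mulrACA.
  rewrite -mulr_suml hVh.
  over.
by rewrite -mulr_sumr ggV Iv_eqE -natrM mulnb andbC.
Qed.

Lemma potential_invE A B u :
  sh F u.1.1 \in unitmx -> sg F u \in unitmx ->
  potential_inv F u A B = potential_inv_comp A B u.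
Proof.
move=> h_unit g_unit.
pose Q : 'M[R]_#|{: idx}| :=
  \matrix_(r, s) potential_inv_comp (enum_val r) (enum_val s) u.
have PQ : potential_mx F u *m Q = 1%:M.
  apply/matrixP => r s; rewrite !mxE.
  rewrite -(inj_eq enum_val_inj) -(potential_comp_mulV _ _ h_unit g_unit).
  rewrite [RHS](reindex (enum_val : 'I_#|{: idx}| -> idx)) /=; last first.
    by exists enum_rank => E _; rewrite ?enum_valK ?enum_rankK.
  by apply: eq_bigr => t _; rewrite !mxE potential_frame.
(* For square matrices a right inverse suffices. *)
have [P_unit _] := mulmx1_unit PQ.
have -> : potential_inv F u A B = Q (enum_rank A) (enum_rank B).
  by rewrite /potential_inv -[Q](mulKmx P_unit) PQ mulmx1.
by rewrite mxE !enum_rankK.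
Qed.

(** Since the inverse is block diagonal, the mixed Ricci components drop out whether or not they
    vanish. *)
Lemma scalar_curvatureE u :
  sh F u.1.1 \in unitmx -> sg F u \in unitmx ->
  scalar_curvature F u = scalH F u + scalR F u + scalS F u.
Proof.
move=> h_unit g_unit; rewrite /scalar_curvature.
under eq_bigr => A _ do under eq_bigr => B _ do
  rewrite potential_invE // ricci_compE.
rewrite sum_jindex; congr (_ + _ + _).
- apply: eq_bigr => al _; rewrite sum_jindex.
  rewrite [X in _ + X + _]big1 => [|i _]; last by rewrite mul0r.
  rewrite [X in _ + X]big1 => [|i _]; last first.
    by rewrite big1 // => be _; rewrite mul0r.
  by rewrite !addr0.
- apply: eq_bigr => i _; rewrite sum_block_space //.
  by case=> [[?|?]|[? ?]] // _; rewrite mul0r.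
- rewrite /scalS; under [RHS]eq_bigr do rewrite exchange_big /=.
  rewrite [RHS]exchange_big; apply: eq_bigr => i _; apply: eq_bigr => al _.
  rewrite sum_block_vert; last by case=> [[?|?]|[? ?]] // _; rewrite mul0r.
  by rewrite exchange_big.
Qed.

(** * Reduction of the Einstein equation to frame components *)

Lemma ricci_frame A B u :
  ricci F u (frame F A u) (frame F B u) = ricci_comp F A B u.
Proof. exact: (sum_frame_bilinear A B (fun C D => ricci_comp F C D u)). Qed.

(* Both sides of the Einstein equation are bilinear, so it may be tested on
   pairs of vectors of the adapted frame. *)
Lemma einstein_componentsP (c k : R) (S : V -> V -> R) u :
  (forall w, scalar (fun v => S v w)) -> (forall v, scalar (S v)) ->
  (forall v w, ricci F u v w - c * potential F u v w = k * S v w) <->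
  (forall A B, ricci_comp F A B u - c * potential_comp A B u
               = k * S (frame F A u) (frame F B u)).
Proof.
move=> Sl Sr.
(* Linearity with factor -1 at two zero vectors reads $S(0,w)=-S(0,w)+S(0,w)$. *)
have S0l w : S 0 w = 0.
  by have := Sl w (-1) 0 0; rewrite scaler0 addr0 mulN1r addNr.
have S0r v : S v 0 = 0.
  by have := Sr v (-1) 0 0; rewrite scaler0 addr0 mulN1r addNr.
have SE v w : S v w = \sum_A \sum_B coframe F A u v * coframe F B u w
                                    * S (frame F A u) (frame F B u).
  have suml (I : finType) (a : I -> R) (e : I -> V) x :
      S (\sum_i a i *: e i) x = \sum_i a i * S (e i) x.
    apply: (big_ind2 (fun y z => S y x = z)) => // [y y' z z' <- <-|i _].
      by rewrite -[y]scale1r Sl mul1r scale1r.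
    by rewrite -[_ *: _]addr0 Sl S0l addr0.
  have sumr (I : finType) (a : I -> R) (e : I -> V) x :
      S x (\sum_i a i *: e i) = \sum_i a i * S x (e i).
    apply: (big_ind2 (fun y z => S x y = z)) => // [y y' z z' <- <-|i _].
      by rewrite -[y]scale1r Sr mul1r scale1r.
    by rewrite -[_ *: _]addr0 Sr S0r addr0.
  rewrite {1}(frame_decomp u v) suml; apply: eq_bigr => A _.
  rewrite {1}(frame_decomp u w) sumr mulr_sumr.
  by apply: eq_bigr => B _; rewrite mulrA.
split=> [einstein A B|einstein v w].
  by rewrite -einstein ricci_frame potential_frame.
rewrite potentialE /ricci SE !mulr_sumr -sumrB; apply: eq_bigr => A _.
rewrite !mulr_sumr -sumrB; apply: eq_bigr => B _.
by rewrite mulrCA -mulrBr einstein mulrCA.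
Qed.

End AdaptedFrame.

(** * The local form of the Einstein equations *)

Theorem theorem4p3 (R : realType) (p n : nat)
    (T : manifold R p) (M : manifold R n)
    (L : gml_space T M) (N : spatial_connection L)
    (K : R) (hK : K != 0) (SE : stress_energy T M)
    (a : atlas T) (b : atlas M) (u : jet R p n)
    (hu : jet_dom (chart_at a) (chart_at b) u) :
  let F := fields_at N a b in
  let SEc (A B : jindex p n) := SE a b u (frame F A u) (frame F B u) in
  let half := (scalH F u + scalR F u + scalS F u) / 2 in
  (forall v w : jet R p n,
     ricci F u v w - scalar_curvature F u / 2 * potential F u v w
     = K * SE a b u v w)
  <->
  ((forall al be : 'I_p,
      ricH F al be u - half * sh F u.1.1 al be = K * SEc (It al) (It be)) /\
   (forall i j : 'I_n,
      ricR F i j u - half * sg F u i j = K * SEc (Ix i) (Ix j)) /\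
   (forall (al be : 'I_p) (i j : 'I_n),
      ricS F al be i j u - half * (hinv F u.1.1 al be * sg F u i j)
      = K * SEc (Iv i al) (Iv j be)) /\
   (forall (al : 'I_p) (i : 'I_n), 0 = SEc (It al) (Ix i)) /\
   (forall (i : 'I_n) (al : 'I_p),
      ricRt F i al u = K * SEc (Ix i) (It al)) /\
   (forall (al be : 'I_p) (i : 'I_n),
      ricPvt F al i be u = K * SEc (Iv i al) (It be)) /\
   (forall (al be : 'I_p) (i : 'I_n), 0 = SEc (It al) (Iv i be)) /\
   (forall (al : 'I_p) (i j : 'I_n),
      ricPxv F i al j u = K * SEc (Ix i) (Iv j al)) /\
   (forall (al : 'I_p) (i j : 'I_n),
      ricPvx F al i j u = K * SEc (Iv i al) (Ix j))).
Proof.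
move=> F SEc half.
have h_unit : sh F u.1.1 \in unitmx by apply: hmet_unit; case: hu.
have g_unit : sg F u \in unitmx.
  by rewrite -row_free_unit /row_free; apply/eqP; exact: gml_g_rank hu.
have sc : scalar_curvature F u / 2 = half by rewrite scalar_curvatureE.
rewrite sc.
have := @einstein_componentsP R p n F half K (SE a b u) u
          (fun w => se_linear_l SE w hu)
          (fun v => se_linear_r SE v hu).
move=> [to_comp of_comp]; split=> [/to_comp eqc|].
  have {}eqc A B := esym (etrans (esym (congr1 (fun x => x - _)
    (ricci_compE F A B u))) (eqc A B)).
  (* For a temporal first index and a nontemporal second one, Ricci and potential are both zero, and
     [K != 0] turns $K\,{\cal T}_{AB}=0$ into ${\cal T}_{AB}=0$. The converse direction only
     multiplies by [K]. *)
  have K0 x : K * x = 0 - half * 0 -> 0 = x.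
    by rewrite mulr0 subrr => /eqP; rewrite mulf_eq0 (negbTE hK) => /eqP.
  have half0 x y : x = y - half * 0 -> y = x by rewrite mulr0 subr0.
  split=> [al be|]; first by rewrite (eqc (It al) (It be)).
  split=> [i j|]; first by rewrite (eqc (Ix i) (Ix j)).
  split=> [al be i j|]; first by rewrite (eqc (Iv i al) (Iv j be)).
  split=> [al i|]; first exact: K0 (eqc (It al) (Ix i)).
  split=> [i al|]; first exact: half0 (eqc (Ix i) (It al)).
  split=> [al be i|]; first exact: half0 (eqc (Iv i al) (It be)).
  split=> [al be i|]; first exact: K0 (eqc (It al) (Iv i be)).
  split=> [al i j|al i j]; first exact: half0 (eqc (Ix i) (Iv j al)).
  exact: half0 (eqc (Iv i al) (Ix j)).
move=> [tt [xx [vv [tx [xt [vt [tv [xv vx]]]]]]]].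
apply: of_comp => A B; rewrite ricci_compE.
case: A B => [[al|i]|[i al]] [[be|j]|[j be]]; rewrite /potential_comp;
  rewrite ?mulr0 ?subr0.
- exact: tt.
- by rewrite -[SE _ _ _ _ _]tx mulr0.
- by rewrite -[SE _ _ _ _ _]tv mulr0.
- exact: xt.
- exact: xx.
- exact: xv.
- exact: vt.
- exact: vx.
- exact: vv.
Qed.
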